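(* Let $K$ be a subfield of the field $\mathbb{R}$ of real numbers, regarded as an ordered field with the order induced from $\mathbb{R}$. Let $D\subseteq K$ be a discrete set, let $n\in\mathbb{N}$, and let $f:D^n\to K$ be a function such that $f(D^n)$ is somewhere dense in $K$. Then the structure $(K,f)$ defines $\mathbb{Z}$.
   Context: A set is discrete if each of its points is isolated (in the order topology). A set is somewhere dense if its topological closure has nonempty interior. $(K,f)$ denotes the expansion of the ordered field $(K,<,+,\cdot)$ by (the graph of) $f$. ''Defines'' means definable in the first-order sense with parameters; ''defines $\mathbb{Z}$'' means the subset $\mathbb{Z}\subseteq K$ is definable. *)

(* Defs.v *)
From HB Require Import structures.
From mathcomp Require Import all_boot all_order all_algebra.
From mathcomp Require Import boolp classical_sets functions reals topology.

Set Implicit Arguments.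
Unset Strict Implicit.
Unset Printing Implicit Defensive.

Import Order.TTheory GRing.Theory Num.Theory.

Local Open Scope classical_set_scope.
Local Open Scope ring_scope.

(* A subfield of R is given by K : divringClosed R, a predicate containing 1
   and closed under subtraction and division (x / 0 = 0 in a field);
   [subfield_of K] is its type of elements. *)
Record subfield_of (R : realType) (K : divringClosed R) : Type :=
  SubfieldOf { subfield_val : R; _ : subfield_val \in K }.

Section SubfieldInstances.
Variables (R : realType) (K : divringClosed R).

HB.instance Definition _ := [isSub for @subfield_val R K].
HB.instance Definition _ := [Choice of subfield_of K by <:].
HB.instance Definition _ :=
  [SubChoice_isSubIntegralDomain of subfield_of K by <:].
HB.instance Definition _ :=
  [SubIntegralDomain_isSubField of subfield_of K by <:].

Let le (x y : subfield_of K) := val x <= val y.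
Let lt (x y : subfield_of K) := val x < val y.
Let norm (x : subfield_of K) : subfield_of K := if le 0 x then x else - x.

Let le0_add x y : le 0 x -> le 0 y -> le 0 (x + y).
Proof. by rewrite /le rmorphD raddf0; apply: addr_ge0. Qed.

Let le0_mul x y : le 0 x -> le 0 y -> le 0 (x * y).
Proof. by rewrite /le rmorphM raddf0; apply: mulr_ge0. Qed.

Let le0_anti x : le 0 x -> le x 0 -> x = 0.
Proof.
rewrite /le => x0 x0'; apply: val_inj; apply/eqP.
by rewrite eq_le x0' x0.
Qed.

Let sub_ge0 x y : le 0 (y - x) = le x y.
Proof. by rewrite /le rmorphB raddf0 subr_ge0. Qed.

Let le0_total x : le 0 x || le x 0.
Proof. exact: le_total. Qed.

Let normN x : norm (- x) = norm x.
Proof.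
rewrite /norm /le rmorphN raddf0 oppr_ge0 opprK.
case: (ltgtP (val x) 0) => // x0.
have -> : x = 0 by apply: val_inj; rewrite x0 raddf0.
by rewrite oppr0.
Qed.

Let ge0_norm x : le 0 x -> norm x = x.
Proof. by rewrite /norm => ->. Qed.

Let lt_def x y : lt x y = (y != x) && le x y.
Proof. by rewrite /lt /le lt_def (inj_eq val_inj). Qed.

HB.instance Definition _ := Num.IntegralDomain_isLeReal.Build (subfield_of K)
  le0_add le0_mul le0_anti sub_ge0 le0_total normN ge0_norm lt_def.

Lemma le_subfield_val (x y : subfield_of K) :
  (subfield_val x <= subfield_val y) = (x <= y).
Proof. by []. Qed.

Lemma lt_subfield_val (x y : subfield_of K) :
  (subfield_val x < subfield_val y) = (x < y).
Proof. by []. Qed.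

End SubfieldInstances.

Definition discrete_subset (T : topologicalType) (A : set T) : Prop :=
  A `<=` isolated A.

Definition somewhere_dense (T : topologicalType) (A : set T) : Prop :=
  interior (closure A) !=set0.

(* First-order formulas, with de Bruijn indices, in the language of ordered
   rings without constants (order, sum, product) extended by one m-ary relation
   symbol. *)
Inductive term : Type :=
| Var of nat
| Add of term & term
| Mul of term & term.

Inductive formula (m : nat) : Type :=
| Eq of term & term
| Lt of term & term
| Rel of m.-tuple term
| Not of formula m
| And of formula m & formula m
| Ex of formula m.

Section Semantics.
Variables (F : realFieldType) (m : nat) (P : set (m.-tuple F)).

Fixpoint eval (e : seq F) (t : term) : F :=
  match t with
  | Var i => e`_i
  | Add t1 t2 => eval e t1 + eval e t2
  | Mul t1 t2 => eval e t1 * eval e t2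
  end.

Fixpoint holds (e : seq F) (phi : formula m) : Prop :=
  match phi with
  | Eq t1 t2 => eval e t1 = eval e t2
  | Lt t1 t2 => eval e t1 < eval e t2
  | Rel ts => P [tuple of map (eval e) ts]
  | Not phi1 => ~ holds e phi1
  | And phi1 phi2 => holds e phi1 /\ holds e phi2
  | Ex phi1 => exists x : F, holds (x :: e) phi1
  end.

(* Definability in the expansion of the ordered field F by P, with the
   parameters listed in e. An index
   beyond the valuation evaluates to 0, which is itself definable. *)
Definition definable (A : set F) : Prop :=
  exists (phi : formula m) (e : seq F), A = [set x | holds (x :: e) phi].

End Semantics.

Definition fun_graph (T : Type) (D : set T) (n : nat) (f : n.-tuple D -> T) :
    set (n.+1.-tuple T) :=
  [set [tuple of rcons (map val d) (f d)] | d in [set: n.-tuple D]].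

Definition integers (F : realFieldType) : set F :=
  range (fun z : int => z%:~R : F).
Arguments integers F : clear implicits.

(* Main.v *)
Require Import Defs.
From HB Require Import structures.
From mathcomp Require Import all_boot all_order all_algebra.
From mathcomp Require Import boolp classical_sets functions reals topology.
From mathcomp Require Import lra.

(** The points of D that are bounded by 1/eps and eps-separated from the rest of
    D form a finite set, so their tuples have a finite image under f; these
    images increase to the range of f as eps decreases. "p appears no later than
    q" is thus a definable total preorder on the range with finite initial
    segments. Given a and c, a record of a is a point q < a such that no point
    in ]q, a[ appears as early as q; at the time of q, let ]p, p'[ be the gap
    around c between the points present, and read off (c - p) / (p' - c).
    Density lets us choose a and c so that the records of a in a given interval
    produce values arbitrarily close to 1, ..., N and no others: shrinking the
    range of a delays its next record until c can be placed in a gap at will.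
    As K is archimedean, x is then a natural number as soon as, for every delta,
    some such finite set of positive values comes within delta of x and is
    closed, up to delta, under descent by 1 until 1 is reached. *)

Set Implicit Arguments.
Unset Strict Implicit.

Import Order.TTheory GRing.Theory Num.Theory.

Local Open Scope classical_set_scope.
Local Open Scope ring_scope.

(** * Minima and tuples over finite sequences *)

Lemma seq_least (T : eqType) (r : T -> T -> Prop) (A : set T) (s : seq T) :
  (forall x y z, r x y -> r y z -> r x z) -> (forall x y, r x y \/ r y x) ->
  (exists2 x, x \in s & A x) ->
  exists m, [/\ m \in s, A m & forall x, x \in s -> A x -> r m x].
Proof.
move=> rtr rtot; elim: s => [|z s IH] [x xs Ax]; first by rewrite in_nil in xs.
have rr t : r t t by case: (rtot t t).
have [[y ys Ay]|none] := pselect (exists2 y, y \in s & A y).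
  have [m [ms Am mmin]] := IH (ex_intro2 _ _ y ys Ay).
  have [Az|nAz] := pselect (A z); last first.
    exists m; split => // [|t]; first by rewrite inE ms orbT.
    by rewrite inE => /orP[/eqP->|]; [|exact: mmin].
  have [rzm|rmz] := rtot z m.
    exists z; split => // [|t]; first by rewrite inE eqxx.
    rewrite inE => /orP[/eqP->//|ts At].
    exact: rtr rzm (mmin _ ts At).
  exists m; split => // [|t]; first by rewrite inE ms orbT.
  by rewrite inE => /orP[/eqP->|]; [|exact: mmin].
have zx : z = x.
  by move: xs; rewrite inE => /orP[/eqP//|xs]; case: none; exists x.
exists z; split => [||t]; rewrite ?inE ?eqxx ?zx //.
by move=> /orP[/eqP->//|ts At]; case: none; exists t.
Qed.

Lemma size_tuples_finite (T : eqType) (s : seq T) (n : nat) :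
  exists L : seq (seq T), forall t, size t = n -> {subset t <= s} -> t \in L.
Proof.
elim: n => [|n [L HL]].
  by exists [:: [::]] => t /size0nil ->; rewrite inE.
exists [seq x :: t | x <- s, t <- L] => -[//|x t] [szt] ts.
apply/allpairsP; exists (x, t); split => //=; first by apply: ts; rewrite inE eqxx.
by apply: HL => // y yt; apply: ts; rewrite inE yt orbT.
Qed.

(** * Coding natural numbers by the records of a dense set *)

Section Coding.
Variables (F : realFieldType) (S : set F) (le : F -> F -> Prop).

Definition record (a q : F) : Prop :=
  [/\ S q, q < a & forall q', S q' -> q < q' -> q' < a -> ~ le q' q].

Definition gap (q p p' : F) : Prop :=
  [/\ S p /\ le p q, S p' /\ le p' q &
      forall r, S r -> le r q -> p < r -> ~ r < p'].

(* The last equation says y = (c - p) / (p' - c). *)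
Definition gap_ratio (a c l u y : F) : Prop :=
  exists q p p', [/\ record a q /\ (l < q /\ ~ u < q), gap q p p',
                     p < c /\ c < p' & y * p' + p = c + y * c].

(** Arranged for a language without constants and subtraction: [delta < delta + delta] and
    [y < y + y] express positivity, pairs of strict inequalities express a distance below [delta],
    and the unit is an argument. *)
Definition coded (one x : F) : Prop :=
  forall delta, delta < delta + delta ->
  exists a c l u,
    (exists y, gap_ratio a c l u y /\ (y < x + delta /\ x < y + delta)) /\
    forall y, gap_ratio a c l u y ->
      y < y + y /\
      ((y < one + delta /\ one < y + delta) \/
       exists y', gap_ratio a c l u y' /\
         (y < one + y' + delta /\ one + y' < y + delta)).

(** At most one natural number lies within 1/4 of [x]; if it differed from [x], a strictly closer
    one would have to be that same number. *)
Lemma natr_of_approx (x : F) :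
  (forall eta, 0 < eta -> exists m : nat, `|x - m%:R| < eta) ->
  exists m : nat, x = m%:R.
Proof.
move=> app; have [m0 Hm0] := app 4^-1 ltac:(lra).
exists m0; apply/eqP/negPn/negP => xm0.
have pos : 0 < `|x - m0%:R| by rewrite normr_gt0 subr_eq0.
have [m Hm] := app _ pos.
suff mm0 : m = m0 by rewrite mm0 ltxx in Hm.
apply/eqP; rewrite -(eqr_nat F) -subr_eq0 -[X in X == _]opprB oppr_eq0.
have : `|m0%:R - m%:R| < 1 :> F.
  have := ler_distD x m0%:R m%:R; rewrite (distrC m0%:R x); lra.
have [lt|lt|->] := ltngtP m m0; rewrite ?subrr //.
  by rewrite -natrB ?(ltnW lt)// normr_nat ltrn1 ltnS leqn0 eqn0Ngt subn_gt0 lt.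
by rewrite distrC -natrB ?(ltnW lt)// normr_nat ltrn1 ltnS leqn0 eqn0Ngt subn_gt0 lt.
Qed.

(** A descent step lowers [y] by more than 1 - [delta] >= 1/2, so [2 * y] drops by more than 1 and
    [k] bounds the number of steps; each step adds an error below [delta]. *)
Lemma descent_near_nat (X : set F) (delta : F) :
  0 < delta -> delta <= 2^-1 ->
  (forall y, X y -> 0 < y /\
     (`|y - 1| < delta \/ exists2 y', X y' & `|y - 1 - y'| < delta)) ->
  forall (k : nat) y, X y -> 2 * y < k%:R ->
  exists m : nat, `|y - m%:R| < delta * k%:R.
Proof.
move=> d0 d1 HX; elim=> [|k IH] y Xy yk.
  by have [] := HX y Xy; lra.
have [y0 [y1|[y' Xy' yy']]] := HX y Xy.
  exists 1%N; apply: lt_le_trans y1 _.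
  by rewrite -natr1 mulrDr mulr1 lerDr mulr_ge0// ltW.
have lek : 2 * y' < k%:R.
  rewrite -natr1 in yk; move: yy'; rewrite ltr_norml => /andP[h _]; lra.
have [m Hm] := IH y' Xy' lek.
exists m.+1; rewrite -!natr1 mulrDr mulr1.
have -> : y - (m%:R + 1) = (y - 1 - y') + (y' - m%:R) by lra.
by have := ler_normD (y - 1 - y') (y' - m%:R); lra.
Qed.

Lemma coded_natr (x : F) : (forall z : F, exists k : nat, z < k%:R) ->
  coded 1 x -> exists m : nat, x = m%:R.
Proof.
move=> archi cx; apply: natr_of_approx => eta eta0.
(* The descent starts at some y < x + 1/2, so [k] bounds its length; the factor k + 1 in [delta]
   leaves room for the error between x and y. *)
have [k Hk] := archi (2 * (x + 1)).
have k0 : 0 < k%:R + 1 :> F by rewrite natr1 ltr0n.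
pose delta := Num.min 2^-1 (eta / (k%:R + 1)).
have d0 : 0 < delta by rewrite lt_min divr_gt0// andbT; lra.
have d1 : delta <= 2^-1 by rewrite ge_min lexx.
have d2 : delta * (k%:R + 1) <= eta.
  by rewrite -ler_pdivlMr// ge_min lexx orbT.
have [a [c [l [u [[y [Xy [yx xy]]] desc]]]]] := cx delta ltac:(lra).
have := @descent_near_nat (gap_ratio a c l u) delta d0 d1.
case/(_ _ k y Xy) => [z Xz||m Hm]; last first.
- exists m; apply: lt_le_trans d2; rewrite mulrDr mulr1.
  have -> : x - m%:R = (x - y) + (y - m%:R) by lra.
  have xyd : `|x - y| < delta by rewrite ltr_norml; lra.
  by have := ler_normD (x - y) (y - m%:R); lra.
- lra.
have [z0 [z1|[z' [Xz' zz']]]] := desc z Xz; split; try lra.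
  by left; rewrite ltr_norml; lra.
by right; exists z' => //; rewrite ltr_norml; lra.
Qed.

Hypothesis le_tr : forall x y z, le x y -> le y z -> le x z.
Hypothesis le_tot : forall x y, le x y \/ le y x.
Hypothesis le_fin : forall q, S q ->
  exists s : seq F, forall p, S p -> le p q -> p \in s.
Variables (lo hi : F).
Hypothesis lohi : lo < hi.
Hypothesis S_dense : forall u v, lo <= u -> u < v -> v <= hi ->
  exists p, [/\ S p, u < p & p < v].

Let le_refl x : le x x. Proof. by case: (le_tot x x). Qed.

(** Only finitely many points appear no later than [q]. *)
Lemma least_above (A : set F) (q u : F) : S q ->
  (exists p, [/\ S p, le p q, u < p & A p]) ->
  exists p, [/\ S p, le p q, u < p, A p &
                forall r, S r -> le r q -> u < r -> A r -> p <= r].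
Proof.
move=> Sq [p0 [Sp0 lp0 up0 Ap0]]; have [s Hs] := le_fin Sq.
have [|||p [_ [Sp lp up Ap] pmin]] := @seq_least _ (fun x y : F => x <= y)
    (fun p => [/\ S p, le p q, u < p & A p]) s.
- by move=> x y z; exact: le_trans.
- by move=> x y; apply/orP; exact: le_total.
- by exists p0 => //; exact: Hs.
by exists p; split => // r Sr lr ur Ar; apply: pmin => //; exact: Hs.
Qed.

Lemma earliest_rightmost (u v : F) : lo <= u -> u < v -> v <= hi ->
  exists q, [/\ S q, u < q, q < v,
    (forall p, S p -> u < p -> p < v -> le q p) &
    (forall p, S p -> q < p -> p < v -> ~ le p q)].
Proof.
move=> lu uv vh; have [q0 [Sq0 uq0 q0v]] := S_dense lu uv vh.
have [s Hs] := le_fin Sq0.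
(* Earlier comes first; ties in time, which can occur, go to the larger point. It suffices to
   compare the finitely many points no later than [q0]. *)
pose r (x y : F) := le x y /\ (le y x -> y <= x).
have [|||q [_ [Sq uq qv] qmin]] := @seq_least _ r
    (fun p => [/\ S p, u < p & p < v]) s.
- move=> x y z [xy xy'] [yz yz']; split; first exact: le_tr xy yz.
  move=> zx; apply: (@le_trans _ _ y).
    by apply: yz'; exact: le_tr zx xy.
  by apply: xy'; exact: le_tr yz zx.
- move=> x y; rewrite /r.
  have [xy|nxy] := pselect (le x y); have [yx|nyx] := pselect (le y x).
  + by have /orP[h|h] := le_total x y; [right|left].
  + by left.
  + by right.
  + by case: (le_tot x y).
- by exists q0 => //; exact: Hs.
have early p : S p -> u < p -> p < v -> le q p.
  move=> Sp up pv; have [pq0|q0p] := le_tot p q0.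
    by have [] := qmin p (Hs _ Sp pq0) ltac:(by []).
  apply: le_tr q0p.
  by have [] := qmin q0 (Hs _ Sq0 (le_refl _)) ltac:(by []).
exists q; split => // p Sp qp pv pq.
have up := lt_trans uq qp.
have pq0 : le p q0 by apply: le_tr pq _; exact: early.
have [_ /(_ pq)] := qmin p (Hs _ Sp pq0) ltac:(by []).
by rewrite leNgt qp.
Qed.

(** Finitely many points appear no later than [r]; stopping at the first of them to the right of [u]
    avoids them all. *)
Lemma clear_right (r u v : F) : S r -> u < v ->
  exists w, [/\ u < w, w <= v & forall p, S p -> u < p -> p < w -> ~ le p r].
Proof.
move=> Sr uv.
have [ex|nex] := pselect (exists p, [/\ S p, le p r, u < p & p < v]).
  have [p [Sp lp up pv pmin]] := least_above Sr ex.
  exists p; split => //; first exact: ltW.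
  move=> t St ut tp ltr; have := pmin t St ltr ut (lt_trans tp pv).
  by rewrite leNgt tp.
exists v; split => // p Sp up pv lpr; apply: nex; by exists p.
Qed.

(* One round of the construction: u' is the next record of every a in ]u', v'[,
   and at time u' every c in ]c1', c2'[ lies in a gap that c divides in a ratio
   close to k. The gap fits inside ]c1, c2[ because u' comes after two points
   of that interval. *)
Lemma next_record (delta u v c1 c2 : F) (k : nat) :
  0 < delta -> (0 < k)%N -> lo <= u -> u < v -> v <= hi ->
  lo <= c1 -> c1 < c2 -> c2 <= hi ->
  exists u' v' c1' c2' p p',
  [/\ [/\ S u', u < u', u' < v' & v' <= v], [/\ c1 <= c1', c1' < c2' & c2' <= c2],
      gap u' p p',
      (forall c, c1' < c -> c < c2' -> [/\ p < c, c < p' &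
          forall y, y * p' + p = c + y * c -> `|y - k%:R| < delta]) &
      (forall a q, u' < a -> a < v' -> u < q -> (record a q /\ q <= u') <-> q = u')].
Proof.
move=> d0 k0 lu uv vh lc1 c12 c2h.
have [r [Sr c1r rc2]] := S_dense lc1 c12 c2h.
have [r' [Sr' rr' r'c2]] := S_dense (le_trans lc1 (ltW c1r)) rc2 c2h.
(* Nothing in ]u, w[ appears as early as [r] or [r'], so the next record [q] comes after both. *)
have [w1 [uw1 w1v clear1]] := clear_right Sr uv.
have [w [uw ww1 clear2]] := clear_right Sr' uw1.
have wv := le_trans ww1 w1v.
have [q [Sq uq qw early rightm]] := earliest_rightmost lu uw (le_trans wv vh).
have lrq : le r q.
  have [//|lqr] := le_tot r q.
  by case: (clear1 q Sq uq (lt_le_trans qw ww1)).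
have lr'q : le r' q.
  by have [//|lqr] := le_tot r' q; case: (clear2 q Sq uq qw).
(* [p'] is the next point after [r] present at time [q]; being at most [r'], it keeps the gap ]r,
   p'[ inside ]c1, c2[. *)
have [|p' [Sp' lp' rp' p'r' p'min]] :=
    @least_above (fun x => x <= r') q r Sq; first by exists r'.
(* The point p' - g divides ]r, p'[ in the exact ratio k. *)
pose g := (p' - r) / (k%:R + 1).
have k1 : 1 <= k%:R :> F by rewrite ler1n.
have g0 : 0 < g by rewrite divr_gt0 //; lra.
have gE : g * k%:R + g = p' - r.
  by rewrite -[X in _ + X]mulr1 -mulrDr divfK //; apply: lt0r_neq0; lra.
(* For c within [eta] of p' - g, the first bound keeps p' - c >= g / 2, and the second makes the
   error in the ratio less than [delta]. *)
pose eta := Num.min (g / 2) (delta * g / 2 / (k%:R + 1)).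
have eta0 : 0 < eta.
  rewrite lt_min; apply/andP; split; first by rewrite divr_gt0.
  by apply: divr_gt0; [rewrite divr_gt0// mulr_gt0|lra].
have eta1 : eta <= g / 2 by rewrite ge_min lexx.
have eta2 : eta * (k%:R + 1) <= delta * g / 2.
  by rewrite -ler_pdivlMr ?ge_min ?lexx ?orbT//; lra.
have gk : g <= g * k%:R by rewrite ler_peMr// ltW.
exists q, w, (p' - g - eta), (p' - g + eta), r, p'; split.
- by split.
- by split; lra.
- split => // t St ltq rt tp'.
  by have := p'min t St ltq rt (ltW (lt_le_trans tp' p'r')); rewrite leNgt tp'.
- move=> c c1c cc2; split; [lra|lra|move=> y yE].
  have pc : g / 2 <= p' - c by lra.
  have pc0 : 0 < p' - c by lra.
  rewrite -(ltr_pM2r pc0) -[X in _ * X](gtr0_norm pc0) -normrM.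
  have -> : (y - k%:R) * (p' - c) = (c - (p' - g)) * (k%:R + 1).
    by move: yE gE; lra.
  have kp : 0 < k%:R + 1 :> F by lra.
  rewrite normrM (gtr0_norm kp).
  apply: (@lt_le_trans _ _ (eta * (k%:R + 1))).
    by rewrite ltr_pM2r// ltr_norml; lra.
  apply: le_trans eta2 _; rewrite -mulrA ler_pM2l//.
(* Were t < q, then [q] would lie between [t] and [a] and appear no later than [t], so [t] would be
   no record. *)
move=> a t qa aw ut; split=> [[[St ta trec] tq]|->]; last first.
  split => //; split => // s Ss qs sa; apply: rightm => //.
  exact: lt_trans sa aw.
apply/eqP; rewrite eq_le tq leNgt; apply/negP => tltq.
by apply: (trec q) => //; apply: early => //; exact: lt_trans ta aw.
Qed.

(** Induction on [N]: [l] stays fixed while [u] moves to the new record, so ]l, u] gains exactly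
    that record, with a value near N + 1. The ranges of [a] and [c] only shrink, so the earlier
    values survive. *)
Lemma codes_initial_segment (delta : F) (N : nat) : 0 < delta ->
  exists l u v c1 c2,
  [/\ lo <= u /\ l <= u, u < v, v <= hi & [/\ lo <= c1, c1 < c2 & c2 <= hi]] /\
  forall a c, u < a -> a < v -> c1 < c -> c < c2 ->
    (forall y, gap_ratio a c l u y ->
       exists k, (0 < k <= N)%N /\ `|y - k%:R| < delta) /\
    (forall k, (0 < k <= N)%N ->
       exists y, gap_ratio a c l u y /\ `|y - k%:R| < delta).
Proof.
move=> d0; elim: N => [|N].
  (* With l = u the window ]l, u] is empty. *)
  exists lo, lo, hi, lo, hi; split; first by repeat split => //; exact: ltW.
  move=> a c _ _ _ _; split=> [y [q [p [p' [[_ [loq nloq]]]]]]|k]; first by [].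
  by rewrite leqn0 lt0n andNb.
case=> [l [u [v [c1 [c2 [[[lou lu] uv vh [lc1 c12 c2h]] IH]]]]]].
have [u' [v' [c1' [c2' [p [p' [[Su' uu' uv' vv'] [lc1' c12' c2h'] gp ratio rec]]]]]]] :=
  @next_record delta u v c1 c2 N.+1 d0 isT lou uv vh lc1 c12 c2h.
exists l, u', v', c1', c2'; split; first by split; [split| | |split]; lra.
move=> a c u'a av' c1c cc2.
have [IH1 IH2] := IH a c ltac:(lra) ltac:(lra) ltac:(lra) ltac:(lra).
have [pc cp' yratio] := ratio c c1c cc2.
have recu' := rec a u' u'a av' uu'.
split=> [y [q [r [r' [[rq [lq qu']] gr rcr' yE]]]]|k /andP[k0]].
  have [qu|uq] := leP q u.
    have [|k [/andP[k0 kN] yk]] := IH1 y.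
      exists q, r, r'; split => //; split => //; split => //.
      by apply/negP; rewrite -leNgt.
    by exists k; rewrite k0 (leq_trans kN).
  have qE : q = u' by apply/(rec a q u'a av' uq); split=> //; rewrite leNgt; apply/negP.
  exists N.+1; split; [by rewrite leqnn|apply: yratio].
  have [[Sr lr] [Sr' lr'] rempty] := gr; have [[Sp lp] [Sp' lp'] pempty] := gp.
  rewrite qE in lr lr' rempty.
  (* Both ]r, r'[ and ]p, p'[ contain [c], have endpoints present at time [u'] and no such point
     inside, so they coincide. *)
  have <- : r = p.
    apply/eqP; rewrite eq_le !leNgt; apply/andP; split; apply/negP => h.
      by apply: (pempty r) => //; lra.
    by apply: (rempty p) => //; lra.
  have <- : r' = p'.
    apply/eqP; rewrite eq_le !leNgt; apply/andP; split; apply/negP => h.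
      by apply: (rempty p') => //; lra.
    by apply: (pempty r') => //; lra.
  exact: yE.
rewrite leq_eqVlt => /orP[/eqP kN|]; last first.
  rewrite ltnS => kN; have [|y [[q [r [r' [[rq [lq qu]] gr rcr' yE]]]] yk]] := IH2 k.
    by rewrite k0.
  exists y; split => //; exists q, r, r'; split => //; split => //; split => //.
  by move=> u'q; apply: qu; lra.
have [_ /(_ erefl)[ru' _]] := recu'.
have yE : (c - p) / (p' - c) * p' + p = c + (c - p) / (p' - c) * c.
  have pc0 : p' - c != 0 by lra.
  have := divfK pc0 (c - p); lra.
exists ((c - p) / (p' - c)); split; last by rewrite kN; exact: yratio.
exists u', p, p'; split => //; split => //; split; first by lra.
by apply/negP; rewrite -leNgt.
Qed.

Lemma natr_coded (m : nat) : (0 < m)%N -> coded 1 m%:R.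
Proof.
move=> m0 delta dd.
(* Comparing y with 1 + y' adds two errors, hence delta / 2; the bound 1/2 keeps the values
   positive. *)
pose d := Num.min (delta / 2) 2^-1.
have d0 : 0 < d by rewrite lt_min; lra.
have d1 : d <= delta / 2 by rewrite ge_min lexx.
have d2 : d <= 2^-1 by rewrite ge_min lexx orbT.
have [l [u [v [c1 [c2 [[_ uv _ [_ c12 _]] H]]]]]] := codes_initial_segment m d0.
exists ((u + v) / 2), ((c1 + c2) / 2), l, u.
have [H1 H2] := H ((u + v) / 2) ((c1 + c2) / 2)
  ltac:(lra) ltac:(lra) ltac:(lra) ltac:(lra).
split.
  have [|y [Xy]] := H2 m; first by rewrite m0 /=.
  by rewrite ltr_norml => ym; exists y; split => //; lra.
move=> y Xy; have [[|k] [/andP[// _ km]]] := H1 y Xy.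
rewrite ltr_norml -natr1 => yk.
have k0 : 0 <= k%:R :> F by [].
split; first by lra.
have [kz|kpos] := posnP k; first by rewrite kz in yk; left; lra.
rewrite -ltnS in km.
right; have [|y' [Xy']] := H2 k; first by rewrite kpos ltnW.
by rewrite ltr_norml => yk'; exists y'; split => //; lra.
Qed.

End Coding.

(** * Finite stages exhausting the range of a function *)

Section Stages.
Variables (F : realFieldType) (n : nat) (G : set (n.+1.-tuple F)).

(** Recovers the set D from the graph, through the constant tuples (d, ..., d). *)
Definition graph_dom (d : F) : Prop := exists y, G [tuple of rcons (nseq n d) y].

(* For eps > 0: d lies in ]-1/eps, 1/eps[ and is at distance at least eps from
   the other points. The inequalities are arranged so as to avoid constants
   and subtraction, which are not in the language. *)
Definition separated (eps d : F) : Prop :=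
  [/\ graph_dom d, eps * eps * d < eps, eps < eps + (eps + eps * eps * d) &
      forall d', graph_dom d' -> [\/ d' = d, ~ d' < d + eps | ~ d < d' + eps]].

Definition stage (eps y : F) : Prop :=
  eps < eps + eps /\
  exists t : n.-tuple F,
    (forall i, separated eps (tnth t i)) /\ G [tuple of rcons t y].

Definition staged (y : F) : Prop := exists eps, stage eps y.

Definition no_later (p q : F) : Prop := forall eps, stage eps q -> stage eps p.

(** The bounds on [d] amount to |e * d| < 1, which passes to the smaller [e']. *)
Lemma separated_anti (e e' d : F) : 0 < e' -> e' <= e ->
  separated e d -> separated e' d.
Proof.
move=> e0 ee' [Dd d1 d2 Hd]; have e0' : 0 < e by lra.
have d3 : e * d < 1 by rewrite -(ltr_pM2l e0') mulrA mulr1.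
have d4 : -1 < e * d by rewrite -(ltr_pM2l e0') mulrA mulrN1; lra.
have [d5 d6] : e' * d < 1 /\ -1 < e' * d.
  by have [dp|dn] := lerP 0 d; split; nra.
split => //.
- by rewrite -mulrA gtr_pMr.
- by have : e' * -1 < e' * (e' * d) by [rewrite ltr_pM2l]; lra.
- by move=> d' /Hd[->|h|h]; [constructor 1|constructor 2|constructor 3]; lra.
Qed.

Lemma stage_anti (e e' y : F) : 0 < e' -> e' <= e -> stage e y -> stage e' y.
Proof.
move=> e0 ee' [_ [t [Ht Gt]]]; split; first by lra.
by exists t; split => // i; apply: separated_anti (Ht i).
Qed.

Lemma no_later_trans (x y z : F) : no_later x y -> no_later y z -> no_later x z.
Proof. by move=> xy yz eps /yz /xy. Qed.

(** By [stage_anti], the parameters at which a point is present form an initial segment of the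
    positive elements, and two such segments are comparable. *)
Lemma no_later_total (x y : F) : no_later x y \/ no_later y x.
Proof.
have [|nxy] := pselect (no_later x y); [by left|right => eps sx].
have /existsNP[e /not_implyP[sy nsx]] := nxy.
have [eps0 _] := sx; apply: (stage_anti _ _ sy); first by lra.
rewrite leNgt; apply/negP => e_eps; apply: nsx.
by apply: (stage_anti _ _ sx); [case: sy; lra|exact: ltW].
Qed.

Hypothesis archi : forall z : F, exists k : nat, z < k%:R.

(** A half-open interval of length [eps] holds at most one separated point; [k] of them are laid end
    to end. *)
Lemma separated_itv_finite (eps : F) (k : nat) (lo : F) :
  exists s : seq F, forall d,
    separated eps d -> lo <= d -> d < lo + eps * k%:R -> d \in s.
Proof.
elim: k lo => [|k IH] lo.
  by exists [::] => d _ lod; rewrite mulr0 addr0 ltNge lod.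
have [s Hs] := IH (lo + eps).
have [[d0 [sd0 lod0 d0lo]]|none] :=
    pselect (exists d, [/\ separated eps d, lo <= d & d < lo + eps]).
  exists (d0 :: s) => d sd lod dlo; rewrite inE.
  have [dlt|dge] := ltP d (lo + eps); last first.
    by rewrite Hs ?orbT //; move: dlo; rewrite -natr1 mulrDr; lra.
  have [[Dd _ _ _] [_ _ _ Hd0]] := (sd, sd0).
  by have [->|[]|[]] := Hd0 d Dd; [rewrite eqxx|lra|lra].
exists s => d sd lod dlo; have [dlt|dge] := ltP d (lo + eps).
  by case: none; exists d.
by apply: Hs => //; move: dlo; rewrite -natr1 mulrDr; lra.
Qed.

Lemma separated_finite (eps : F) : 0 < eps ->
  exists s : seq F, forall d, separated eps d -> d \in s.
Proof.
(* From -1/eps, [k] intervals of length [eps] reach beyond 1/eps. *)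
move=> e0; have [k Hk] := archi (2 / eps / eps).
have [s Hs] := separated_itv_finite eps k (- eps^-1).
exists s => d sd; apply: Hs => //; have [_ d1 d2 _] := sd.
  rewrite -(ler_pM2l e0) mulrN mulfV ?gt_eqF// -(ler_pM2l e0) mulrA; lra.
have h1 : eps^-1 + eps^-1 < eps * k%:R.
  by move: Hk; rewrite ltr_pdivrMr// mulrC; lra.
have h2 : d < eps^-1.
  by rewrite -(ltr_pM2l e0) mulfV ?gt_eqF// -(ltr_pM2l e0) mulrA; lra.
lra.
Qed.

Hypothesis G_fun : forall (t : n.-tuple F) y y',
  G [tuple of rcons t y] -> G [tuple of rcons t y'] -> y = y'.

(** Such a [p] is present at any parameter where [q] is, hence is the value of a tuple from a finite
    set. *)
Lemma no_later_finite (q : F) : staged q ->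
  exists s : seq F, forall p, staged p -> no_later p q -> p \in s.
Proof.
move=> [eps sq]; have [e0 _] := sq.
have [s Hs] := separated_finite (eps := eps) ltac:(lra).
have [L HL] := size_tuples_finite s n.
(* The default 0 serves lists outside the domain; elsewhere [G_fun] makes the value unique. *)
pose value (t : seq F) := xget 0
  [set y | exists t' : n.-tuple F, t = t' /\ G [tuple of rcons t' y]].
exists (map value L) => p _ /(_ eps sq) [_ [t [st Gt]]].
apply/mapP; exists (t : seq F).
  apply: HL; first exact: size_tuple.
  by move=> x /tnthP[i ->]; exact/Hs/st.
apply/esym/xget_unique; first by exists t.
by move=> y [t' [/val_inj <- Gt']]; exact: G_fun Gt' Gt.
Qed.

End Stages.

(** * First-order formulas for the coding, and their semantics *)

Section Formulas.
Variables (F : realFieldType) (n : nat) (G : set (n.+1.-tuple F)).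

Notation form := (formula n.+1).
Notation sat := (holds G).

Definition Or (a b : form) : form := Not (And (Not a) (Not b)).
Definition Imp (a b : form) : form := Not (And a (Not b)).
Definition All (a : form) : form := Not (Ex (Not a)).
Definition ExN (k : nat) (a : form) : form := iter k (@Ex n.+1) a.
Fixpoint AndN (k : nat) (a : nat -> form) : form :=
  if k is k'.+1 then And (AndN k' a) (a k') else Eq _ (Var 0) (Var 0).

Lemma sat_Not e a A : (sat e a <-> A) -> (sat e (Not a) <-> ~ A).
Proof. by move=> [h1 h2]; split=> na x; apply: na; [exact: h2|exact: h1]. Qed.

Lemma sat_And e a b A B : (sat e a <-> A) -> (sat e b <-> B) ->
  (sat e (And a b) <-> A /\ B).
Proof. by move=> /= -> ->. Qed.

Lemma sat_And3 e a b c A B C :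
  (sat e a <-> A) -> (sat e b <-> B) -> (sat e c <-> C) ->
  (sat e (And a (And b c)) <-> [/\ A, B & C]).
Proof. by move=> /= -> -> ->; split=> [[? []]|[]]. Qed.

Lemma sat_And4 e a b c d A B C D :
  (sat e a <-> A) -> (sat e b <-> B) -> (sat e c <-> C) -> (sat e d <-> D) ->
  (sat e (And a (And b (And c d))) <-> [/\ A, B, C & D]).
Proof. by move=> /= -> -> -> ->; split=> [[? [? []]]|[]]. Qed.

Lemma sat_Or e a b A B : (sat e a <-> A) -> (sat e b <-> B) ->
  (sat e (Or a b) <-> A \/ B).
Proof.
move=> /= -> ->; split=> [nab|[x|x] []//].
by have [x|nA] := pselect A; [left|right; apply: contrapT => nB; apply: nab].
Qed.

Lemma sat_Or3 e a b c A B C :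
  (sat e a <-> A) -> (sat e b <-> B) -> (sat e c <-> C) ->
  (sat e (Or a (Or b c)) <-> [\/ A, B | C]).
Proof.
move=> ha hb hc; have := sat_Or ha (sat_Or hb hc) => ->.
by split=> [[?|[?|?]]|[?|?|?]]; [constructor 1|constructor 2|constructor 3| | |]; tauto.
Qed.

Lemma sat_Imp e a b (A B : Prop) : (sat e a <-> A) -> (sat e b <-> B) ->
  (sat e (Imp a b) <-> (A -> B)).
Proof.
move=> /= -> ->; split=> [nab x|ab [x]]; last by apply; exact: ab.
by apply: contrapT => nB; apply: nab.
Qed.

Lemma sat_Ex e a (A : F -> Prop) : (forall x, sat (x :: e) a <-> A x) ->
  (sat e (Ex a) <-> exists x, A x).
Proof. by move=> h; split=> -[x /h hx]; exists x. Qed.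

Lemma sat_All e a (A : F -> Prop) : (forall x, sat (x :: e) a <-> A x) ->
  (sat e (All a) <-> forall x, A x).
Proof.
move=> h; split=> [nex x|al [x]]; last by apply; exact/h.
by apply/h; apply: contrapT => nx; apply: nex; exists x.
Qed.

(** The outermost quantifier binds the last component, so the induction peels tuples from the
    right. *)
Lemma sat_ExN k e a (A : k.-tuple F -> Prop) :
  (forall t : k.-tuple F, sat (t ++ e) a <-> A t) ->
  (sat e (ExN k a) <-> exists t, A t).
Proof.
elim: k e A => [|k IH] e A h.
  split=> [he|[t]]; first by exists [tuple]; apply/h.
  by move/h; rewrite (tuple0 t).
have step x : sat (x :: e) (ExN k a) <->
    exists t : k.-tuple F, A [tuple of rcons t x].
  by apply: IH => t; rewrite -h /= cat_rcons.
split=> [[x /step[t At]]|[t At]]; first by exists [tuple of rcons t x].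
case/lastP et: (tval t) => [|u x]; first by have := size_tuple t; rewrite et.
have su : size u == k.
  by have := size_tuple t; rewrite et size_rcons => -[->].
exists x; apply/step; exists (Tuple su).
by suff -> : [tuple of rcons (Tuple su) x] = t by []; exact: val_inj.
Qed.

Lemma sat_AndN e k (a : nat -> form) :
  sat e (AndN k a) <-> forall i : 'I_k, sat e (a i).
Proof.
elim: k => [|k IH] /=; first by split=> // _ [].
rewrite IH; split=> [[ha hk] i|h].
  by case: (unliftP ord_max i) => [j ->|-> //]; rewrite lift_max.
split; last exact: (h ord_max).
by move=> i; have := h (lift ord_max i); rewrite lift_max.
Qed.

Definition graph_domF (d : nat) : form :=
  Ex (Rel [tuple of rcons (nseq n (Var d.+1)) (Var 0)]).

Lemma graph_domP e d : sat e (graph_domF d) <-> graph_dom G e`_d.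
Proof.
apply: sat_Ex => x /=.
suff -> : [tuple of map (Defs.eval (x :: e)) (rcons (nseq n (Var d.+1)) (Var 0))] =
  [tuple of rcons (nseq n e`_d) x] by [].
by apply: val_inj; rewrite /= map_rcons map_nseq.
Qed.

Definition separatedF (i d : nat) : form :=
  And (graph_domF d)
 (And (Lt _ (Mul (Mul (Var i) (Var i)) (Var d)) (Var i))
 (And (Lt _ (Var i) (Add (Var i) (Add (Var i) (Mul (Mul (Var i) (Var i)) (Var d)))))
      (All (Imp (graph_domF 0)
        (Or (Eq _ (Var 0) (Var d.+1))
        (Or (Not (Lt _ (Var 0) (Add (Var d.+1) (Var i.+1))))
            (Not (Lt _ (Var d.+1) (Add (Var 0) (Var i.+1)))))))))).

Lemma separatedP e i d : sat e (separatedF i d) <-> separated G e`_i e`_d.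
Proof.
apply: sat_And4 => //; first exact: graph_domP.
by apply: sat_All => x; apply: sat_Imp; [exact: graph_domP|exact: sat_Or3].
Qed.

(** The bound tuple takes the indices below n, which shifts the outer ones by n. *)
Definition stageF (i y : nat) : form :=
  And (Lt _ (Var i) (Add (Var i) (Var i)))
      (ExN n (And (AndN n (separatedF (n + i)))
                  (Rel [tuple of rcons (map Var (iota 0 n)) (Var (n + y))]))).

Lemma stageP e i y : sat e (stageF i y) <-> stage G e`_i e`_y.
Proof.
apply: sat_And => //; apply: sat_ExN => t.
have shift j : (t ++ e)`_(n + j) = e`_j.
  by rewrite nth_cat size_tuple ltnNge leq_addr addKn.
apply: sat_And.
  rewrite sat_AndN; split=> h j; have := h j; rewrite separatedP shift;
    by rewrite nth_cat size_tuple ltn_ord -tnth_nth.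
rewrite /=; suff -> : [tuple of map (Defs.eval (t ++ e))
    (rcons [seq Var j | j <- iota 0 n] (Var (n + y)))] =
    [tuple of rcons t e`_y] by [].
apply: val_inj; rewrite /= map_rcons /= shift -map_comp; congr rcons.
apply: (@eq_from_nth _ 0); first by rewrite size_map size_iota size_tuple.
move=> j; rewrite size_map size_iota => jn.
by rewrite (nth_map 0%N) ?size_iota// nth_iota//= nth_cat size_tuple jn.
Qed.

Definition stagedF (y : nat) : form := Ex (stageF 0 y.+1).

Lemma stagedP e y : sat e (stagedF y) <-> staged G e`_y.
Proof. by apply: sat_Ex => x; exact: stageP. Qed.

Definition no_laterF (p q : nat) : form :=
  All (Imp (stageF 0 q.+1) (stageF 0 p.+1)).

Lemma no_laterP e p q : sat e (no_laterF p q) <-> no_later G e`_p e`_q.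
Proof. by apply: sat_All => x; apply: sat_Imp; exact: stageP. Qed.

Definition recordF (a q : nat) : form :=
  And (stagedF q)
 (And (Lt _ (Var q) (Var a))
      (All (Imp (stagedF 0) (Imp (Lt _ (Var q.+1) (Var 0))
        (Imp (Lt _ (Var 0) (Var a.+1)) (Not (no_laterF 0 q.+1))))))).

Lemma recordP e a q :
  sat e (recordF a q) <-> record (staged G) (no_later G) e`_a e`_q.
Proof.
apply: sat_And3 => //; first exact: stagedP.
apply: sat_All => x; apply: sat_Imp; first exact: stagedP.
by do 2!apply: sat_Imp => //; apply: sat_Not; exact: no_laterP.
Qed.

Definition gapF (q p p' : nat) : form :=
  And (And (stagedF p) (no_laterF p q))
 (And (And (stagedF p') (no_laterF p' q))
      (All (Imp (stagedF 0) (Imp (no_laterF 0 q.+1)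
        (Imp (Lt _ (Var p.+1) (Var 0)) (Not (Lt _ (Var 0) (Var p'.+1)))))))).

Lemma gapP e q p p' :
  sat e (gapF q p p') <-> gap (staged G) (no_later G) e`_q e`_p e`_p'.
Proof.
apply: sat_And3; last apply: sat_All => x.
- by apply: sat_And; [exact: stagedP|exact: no_laterP].
- by apply: sat_And; [exact: stagedP|exact: no_laterP].
apply: sat_Imp; first exact: stagedP.
by apply: sat_Imp; [exact: no_laterP|apply: sat_Imp => //; exact: sat_Not].
Qed.

Definition gap_ratioF (a c l u y : nat) : form :=
  Ex (Ex (Ex
    (And (And (recordF a.+3 2) (And (Lt _ (Var l.+3) (Var 2))
                                    (Not (Lt _ (Var u.+3) (Var 2)))))
    (And (gapF 2 1 0)
    (And (And (Lt _ (Var 1) (Var c.+3)) (Lt _ (Var c.+3) (Var 0)))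
         (Eq _ (Add (Mul (Var y.+3) (Var 0)) (Var 1))
               (Add (Var c.+3) (Mul (Var y.+3) (Var c.+3))))))))).

Lemma gap_ratioP e a c l u y : sat e (gap_ratioF a c l u y) <->
  gap_ratio (staged G) (no_later G) e`_a e`_c e`_l e`_u e`_y.
Proof.
do 3!apply: sat_Ex => ?; apply: sat_And4 => //; last exact: gapP.
by apply: sat_And => //; exact: recordP.
Qed.

(** Under the quantifiers, delta, a, c, l, u, y have indices 5 down to 0 and outer variables are
    shifted by 6; the quantifier over y' shifts everything once more. *)
Definition codedF (one x : nat) : form :=
  All (Imp (Lt _ (Var 0) (Add (Var 0) (Var 0)))
  (Ex (Ex (Ex (Ex
    (And (Ex (And (gap_ratioF 4 3 2 1 0)
             (And (Lt _ (Var 0) (Add (Var (6 + x)) (Var 5)))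
                  (Lt _ (Var (6 + x)) (Add (Var 0) (Var 5))))))
    (All (Imp (gap_ratioF 4 3 2 1 0)
      (And (Lt _ (Var 0) (Add (Var 0) (Var 0)))
      (Or (And (Lt _ (Var 0) (Add (Var (6 + one)) (Var 5)))
               (Lt _ (Var (6 + one)) (Add (Var 0) (Var 5))))
          (Ex (And (gap_ratioF 5 4 3 2 0)
              (And (Lt _ (Var 1) (Add (Add (Var (7 + one)) (Var 0)) (Var 6)))
                   (Lt _ (Add (Var (7 + one)) (Var 0)) (Add (Var 1) (Var 6)))))))))))))))).

Lemma codedP e one x :
  sat e (codedF one x) <-> coded (staged G) (no_later G) e`_one e`_x.
Proof.
apply: sat_All => delta; apply: sat_Imp => //; do 4!apply: sat_Ex => ?.
apply: sat_And.
  by apply: sat_Ex => y; apply: sat_And => //; exact: gap_ratioP.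
apply: sat_All => y; apply: sat_Imp; first exact: gap_ratioP.
apply: sat_And => //; apply: sat_Or => //; apply: sat_Ex => y'.
by apply: sat_And => //; exact: gap_ratioP.
Qed.

(** The only parameter is 1, at index 3 behind w, v and z. *)
Lemma definable_coded_differences : definable G
  [set z | exists v w, coded (staged G) (no_later G) 1 v /\
                       (coded (staged G) (no_later G) 1 w /\ z + w = v)].
Proof.
exists (Ex (Ex (And (codedF 3 1) (And (codedF 3 0)
  (Eq _ (Add (Var 2) (Var 0)) (Var 1)))))), [:: 1].
apply/funext => z; apply/propext; apply: iff_sym.
do 2!apply: sat_Ex => ?; apply: sat_And; first exact: codedP.
by apply: sat_And => //; exact: codedP.
Qed.

End Formulas.

(** * Density and discreteness in terms of inequalities *)

Section OrderTopology.
Variable F : realFieldType.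
Local Notation oF := (order_topology F).

Lemma nbhs_order_ball (x : F) (V : set F) : nbhs (x : oF) V ->
  exists2 eta : F, 0 < eta & forall y, `|y - x| < eta -> V y.
Proof.
rewrite order_nbhs_itv => -[[[[]a|[]] [[]b|[]]] [] oi xi iV].
all: try by move: oi => [] .
all: move: xi; rewrite ?in_itv /= ?andbT.
- move=> /andP[ax xb]; exists (Num.min (x - a) (b - x)).
    by rewrite lt_min !subr_gt0; apply/andP.
  move=> y; rewrite lt_min !ltr_norml => h; apply: iV.
  by rewrite /= in_itv /=; lra.
- move=> ax; exists (x - a); first by rewrite subr_gt0.
  move=> y; rewrite !ltr_norml => h; apply: iV.
  by rewrite /= in_itv /= andbT; lra.
- move=> xb; exists (b - x); first by rewrite subr_gt0.
  move=> y; rewrite !ltr_norml => h; apply: iV.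
  by rewrite /= in_itv /=; lra.
by move=> _; exists 1 => // y _; apply: iV; rewrite /= in_itv.
Qed.

Lemma somewhere_dense_itv (A : set F) : somewhere_dense (A : set oF) ->
  exists lo hi : F, lo < hi /\
    forall u v, lo <= u -> u < v -> v <= hi -> exists p, [/\ A p, u < p & p < v].
Proof.
move=> [x /nbhs_order_ball[eta eta0 Heta]].
exists (x - eta), (x + eta); split; first by lra.
move=> u v xu uv vx.
(* The midpoint of ]u, v[ lies in the closure, so this neighbourhood of it meets [A]. *)
have /Heta clA : `|(u + v) / 2 - x| < eta by rewrite ltr_norml; lra.
have [|p [Ap]] := clA ([set` `]u, v[] : set oF).
  by apply: open_nbhs_nbhs; split; [exact: itv_open|rewrite /= in_itv /=; lra].
by rewrite /= in_itv /= => /andP[up pv]; exists p.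
Qed.

Lemma discrete_subset_gap (A : set F) : discrete_subset (A : set oF) ->
  forall d, A d -> exists2 eta, 0 < eta &
    forall d', A d' -> [\/ d' = d, d + eta <= d' | d' + eta <= d].
Proof.
move=> disc d /disc[_ [V /nbhs_order_ball[eta eta0 HV] VA]].
exists eta => // d' Ad'.
have [h1|h1] := leP (d + eta) d'; first by constructor 2.
have [h2|h2] := leP (d' + eta) d; first by constructor 3.
constructor 1; have : (V `&` A) d' by split => //; apply: HV; rewrite ltr_norml; lra.
by rewrite VA.
Qed.

End OrderTopology.

(** * Stages of a function on a discrete set *)

Section FunGraph.
Variables (F : realFieldType) (D : set F) (n : nat) (f : n.-tuple D -> F).
Hypothesis n_gt0 : (0 < n)%N.

Lemma graph_dom_fun_graph (d : F) : graph_dom (fun_graph f) d <-> D d.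
Proof.
split=> [[y [t _ /(congr1 val) /= /rcons_inj[tE _]]]|Dd].
  have /(congr1 (fun s => nth 0 s 0)) := tE.
  rewrite nth_nseq n_gt0 => <-.
  rewrite (nth_map (tnth t (Ordinal n_gt0))) ?size_tuple//.
  exact: set_valP.
pose d0 : D := exist _ d (mem_set Dd).
exists (f [tuple of nseq n d0]), [tuple of nseq n d0] => //.
by apply: val_inj; rewrite /= map_nseq.
Qed.

Lemma fun_graph_fun (t : n.-tuple F) (y y' : F) :
  fun_graph f [tuple of rcons t y] -> fun_graph f [tuple of rcons t y'] -> y = y'.
Proof.
move=> [s _ /(congr1 val) /= /rcons_inj[sE <-]].
move=> [s' _ /(congr1 val) /= /rcons_inj[s'E <-]].
congr f; apply: val_inj; apply: (inj_map val_inj).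
by rewrite [LHS]sE.
Qed.

Hypothesis discD : discrete_subset (D : set (order_topology F)).

Lemma separated_ex (d : F) : D d ->
  exists2 eps, 0 < eps & separated (fun_graph f) eps d.
Proof.
move=> Dd; have [eta eta0 Heta] := discrete_subset_gap discD Dd.
have d0 : 0 < `|d| + 1 by rewrite ltr_wpDl.
(* [eta] gives the separation, the other bound gives |eps * d| < 1. *)
pose eps := Num.min eta (`|d| + 1)^-1.
have e0 : 0 < eps by rewrite lt_min eta0 invr_gt0.
have e1 : eps <= eta by rewrite ge_min lexx.
have e2 : eps * (`|d| + 1) <= 1 by rewrite -ler_pdivlMr// div1r ge_min lexx orbT.
have : `|eps * d| < 1.
  by rewrite normrM (gtr0_norm e0); move: e2; rewrite mulrDr; lra.
rewrite ltr_norml => /andP[e3 e4].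
exists eps => //; split.
- exact/graph_dom_fun_graph.
- by rewrite -mulrA gtr_pMr.
- by have : eps * -1 < eps * (eps * d) by [rewrite ltr_pM2l]; lra.
move=> d' /graph_dom_fun_graph /Heta[->|h|h].
- by constructor 1.
- by constructor 2; lra.
- by constructor 3; lra.
Qed.

(** Discreteness gives each component of a tuple its own parameter; the minimum over the finitely
    many components serves the whole tuple. *)
Lemma staged_range (y : F) : staged (fun_graph f) y <-> range f y.
Proof.
split=> [[eps [_ [t [_ [s _ /(congr1 val) /= /rcons_inj[_ <-]]]]]]|[t _ <-]].
  by exists s.
have [eps e0 Heps] : exists2 eps, 0 < eps &
    forall d, d \in map val t -> separated (fun_graph f) eps d.
  elim: (tval t) => [|d s [eps e0 IH]]; first by exists 1.
  have [eps' e0' Hd] := separated_ex (set_valP d).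
  have m0 : 0 < Num.min eps eps' by rewrite lt_min e0.
  exists (Num.min eps eps') => // x; rewrite inE => /orP[/eqP ->|xs].
    by apply: separated_anti Hd; rewrite // ge_min lexx orbT.
  by apply: separated_anti (IH x xs); rewrite // ge_min lexx.
exists eps; split; first by lra.
exists [tuple of map val t]; split=> [i|]; first by apply: Heps; exact: mem_tnth.
by exists t => //; exact: val_inj.
Qed.

End FunGraph.

(** * Definability of the integers *)

Lemma definable_integers (F : realFieldType) (D : set F) (n : nat)
    (f : n.-tuple D -> F) :
  (forall z : F, exists k : nat, z < k%:R) ->
  discrete_subset (D : set (order_topology F)) ->
  somewhere_dense (range f : set (order_topology F)) ->
  definable (fun_graph f) (integers F).
Proof.
move=> archi discD /somewhere_dense_itv[lo [hi [lohi dense]]].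
(* A function of no arguments has a single value, which cannot lie in both halves of ]lo, hi[. *)
have n_gt0 : (0 < n)%N.
  case: n f dense => [f dense|//].
  have [_ [[t _ <-] _ lt_mid]] := dense lo ((lo + hi) / 2) ltac:(lra) ltac:(lra) ltac:(lra).
  have [_ [[t' _ <-] mid_lt _]] := dense ((lo + hi) / 2) hi ltac:(lra) ltac:(lra) ltac:(lra).
  by move: lt_mid mid_lt; rewrite (tuple0 t) (tuple0 t'); lra.
set G := fun_graph f.
have staged_dense u v : lo <= u -> u < v -> v <= hi ->
    exists p, [/\ staged G p, u < p & p < v].
  move=> lu uv vh; have [p [fp up pv]] := dense u v lu uv vh.
  by exists p; split => //; apply/staged_range.
have coded_nat m : coded (staged G) (no_later G) 1 m.+1%:R.
  have fin := no_later_finite archi (@fun_graph_fun _ _ _ f).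
  exact: (natr_coded (@no_later_trans _ _ G) (@no_later_total _ _ G) fin
                     lohi staged_dense).
suff -> : integers F = [set z | exists v w, coded (staged G) (no_later G) 1 v /\
    (coded (staged G) (no_later G) 1 w /\ z + w = v)].
  exact: definable_coded_differences.
apply/seteqP; split=> [_ [z _ <-]|z [v [w [cv [cw zwv]]]]].
  (* Writing m = (m + 1) - 1 and -(m + 1) = 1 - (m + 2) keeps both terms positive, as [coded_nat]
     demands. *)
  case: z => m.
    exists m.+1%:R, 1%:R; split; first exact: coded_nat.
    by split; [exact: coded_nat|rewrite natr1].
  exists 1%:R, m.+2%:R; split; first exact: coded_nat.
  split; first exact: coded_nat.
  by rewrite NegzE mulrNz -[m.+2%:R]natr1 addKr.
have [a va] := coded_natr archi cv; have [b wb] := coded_natr archi cw.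
exists (a%:Z - b%:Z) => //.
by rewrite intrB -!pmulrn -va -wb -zwv addrK.
Qed.

Unset Implicit Arguments.

Theorem theoremA (R : realType) (K : divringClosed R)
    (D : set (subfield_of K)) (n : nat) (f : n.-tuple D -> subfield_of K)
    (discD : discrete_subset (D : set (order_topology (subfield_of K))))
    (denseF : somewhere_dense
                (range f : set (order_topology (subfield_of K)))) :
  definable (fun_graph f) (integers (subfield_of K)).
Proof.
apply: definable_integers => // z.
(* The archimedean bound in [R] serves in [K], whose order is induced. *)
exists (Num.bound `|val z|); rewrite -lt_subfield_val.
rewrite [ltRHS](rmorph_nat (\val : {rmorphism subfield_of K -> R})).
exact: le_lt_trans (ler_norm _) (archi_boundP (normr_ge0 _)).
Qed.
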